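(* Let $\mathbf{k}$ be a field, let $\Delta$ be an abstract simplicial complex on the vertex set $[n]=\{1,\dots,n\}$, and let $IK_\Delta\subseteq\mathbf{k}[x_1,\dots,x_n]$ be the squarefree monomial ideal minimally generated by the monomials $\prod_{i\in[n]\setminus\sigma}x_i$ where $\sigma$ runs over the facets of $\Delta$. Assume that $IK_\Delta$ has full support. Let $\mathcal{D}(IK_\Delta)$ be a depolarization of $IK_\Delta$, and let $x^\mu$ be the least common multiple of the minimal monomial generators of $\mathcal{D}(IK_\Delta)$. Then \[ \dim_{\mathbf{k}}\widetilde{H}_i(\Delta;\mathbf{k})=\dim_{\mathbf{k}}\widetilde{H}_i\bigl(K^\mu_{\mathcal{D}(IK_\Delta)};\mathbf{k}\bigr)\quad\text{for all } i\in\mathbb{Z}, \] where $K^\mu_{\mathcal{D}(IK_\Delta)}$ is the upper Koszul simplicial complex of $\mathcal{D}(IK_\Delta)$ at $\mu$.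
   Context: Notation. For a multi-index $\mu$, $x^\mu=\prod_i x_i^{\mu_i}$, and for a set $\sigma$ of indices of variables $x_\sigma=\prod_{i\in\sigma}x_i$. $G(I)$ is the unique minimal monomial generating set of a monomial ideal $I$. The support of a monomial is the set of indices of the variables dividing it; a monomial ideal $I$ in a polynomial ring has full support if every variable of the ring divides some element of $G(I)$. $\widetilde{H}$ denotes reduced simplicial homology. Koszul complex. The (upper) Koszul simplicial complex of a monomial ideal $J\subseteq\mathbf{k}[x_1,\dots,x_m]$ at $\mu\in\mathbb{N}^m$ is $K^\mu_J=\{\sigma\subseteq\{1,\dots,m\}\mid x^\mu/x_\sigma\in J\}$ (in particular $x_\sigma$ must divide $x^\mu$). Polarization. Let $J\subseteq S=\mathbf{k}[x_1,\dots,x_m]$ be a monomial ideal and let $x^{\mathbf a}=\operatorname{lcm}(g\mid g\in G(J))$. Put $\mathcal{P}(S)=\mathbf{k}[x_{1,1},\dots,x_{1,a_1},\dots,x_{m,1},\dots,x_{m,a_m}]$. For $\mu\in\mathbb{N}^m$ with $\mu_i\le a_i$ for all $i$, $\mathcal{P}(x^\mu)=\prod_{i=1}^m x_{i,1}\cdots x_{i,\mu_i}$. The polarization of $J$ is $\mathcal{P}(J)=\langle\mathcal{P}(g)\mid g\in G(J)\rangle\subseteq\mathcal{P}(S)$. Depolarization. Let $I\subseteq R$ be a squarefree monomial ideal in a polynomial ring $R$ over $\mathbf{k}$. A depolarization of $I$ is a monomial ideal $J$ in some polynomial ring $S$ over $\mathbf{k}$ such that $I$ is isomorphic to $\mathcal{P}(J)\subseteq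 T=\mathcal{P}(S)$, i.e. there is a bijection $\varphi$ from the variables of $R$ to the variables of $T$ such that (extending $\varphi$ multiplicatively to monomials) $\varphi(G(I))=G(\mathcal{P}(J))$. *)

(* Defs.v *)
From HB Require Import structures.
From mathcomp Require Import all_boot all_order all_algebra.
From mathcomp Require Import boolp.
From mathcomp Require Export mpoly.

Set Implicit Arguments.
Unset Strict Implicit.
Unset Printing Implicit Defensive.

Import GRing.Theory.
Local Open Scope ring_scope.

(* The void complex [set0], the complex [[set set0]] and complexes for which
   some [[set v]] is not a face are all allowed. *)
Definition simplicial_complex (n : nat) (D : {set {set 'I_n}}) : Prop :=
  forall s t : {set 'I_n}, s \in D -> t \subset s -> t \in D.

Definition facet (n : nat) (D : {set {set 'I_n}}) (s : {set 'I_n}) : bool :=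
  maxset [pred t | t \in D] s.

Section Homology.
Variables (k : fieldType) (n : nat).

Definition chain := {ffun {set 'I_n} -> k^o}.

Definition simplex (s : {set 'I_n}) : chain := [ffun t => (t == s)%:R].

(* Position of [v] in the increasing enumeration of [s]. *)
Definition vertex_pos (s : {set 'I_n}) (v : 'I_n) : nat :=
  #|[set w in s | (w < v)%N]|.

Definition boundary_simplex (s : {set 'I_n}) : chain :=
  \sum_(v in s) (-1) ^+ vertex_pos s v *: simplex (s :\ v).

Definition boundary (c : chain) : chain := \sum_s c s *: boundary_simplex s.

Fact boundary_is_linear : linear boundary.
Proof.
move=> a u v; rewrite /boundary scaler_sumr -big_split /=; apply: eq_bigr => s _.
by rewrite !ffunE scalerDl scalerA.
Qed.

HB.instance Definition _ :=
  GRing.isLinear.Build k chain chain *:%R boundary boundary_is_linear.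

(* The empty simplex spans the chains of dimension -1, so that the homology
   below is reduced. *)
Definition chains (D : {set {set 'I_n}}) (i : int) : {vspace chain} :=
  <<[seq simplex s | s in [pred s in D | #|s|%:Z == (i + 1)%R]]>>%VS.

Definition cycles (D : {set {set 'I_n}}) (i : int) : {vspace chain} :=
  (chains D i :&: lker (linfun boundary))%VS.

Definition boundaries (D : {set {set 'I_n}}) (i : int) : {vspace chain} :=
  (linfun boundary @: chains D (i + 1)%R)%VS.

Lemma boundaryE s : boundary (simplex s) = boundary_simplex s.
Proof.
rewrite /boundary (bigD1 s) //= ffunE eqxx scale1r big1 ?addr0 // => t.
by rewrite ffunE => /negPf->; rewrite scale0r.
Qed.

Lemma vertex_posD1 (s : {set 'I_n}) (v w : 'I_n) : v \in s ->
  vertex_pos s w = ((v < w) + vertex_pos (s :\ v) w)%N.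
Proof.
move=> vs; rewrite /vertex_pos (cardsD1 v) inE vs /=; congr (_ + _)%N.
by apply: eq_card => x; rewrite !inE andbA.
Qed.

Lemma boundaryK s : boundary (boundary_simplex s) = 0.
Proof.
rewrite {1}/boundary_simplex linear_sum /=.
under eq_bigr => v vs do rewrite linearZ /= boundaryE scaler_sumr.
pose F v w : chain := (-1) ^+ vertex_pos s v *:
  ((-1) ^+ vertex_pos (s :\ v) w *: simplex (s :\ v :\ w)).
have anti v w : v \in s -> w \in s -> (v < w)%N -> F v w = - F w v.
  move=> vs ws ltvw; rewrite /F !scalerA.
  have -> : s :\ w :\ v = s :\ v :\ w.
    by apply/setP=> x; rewrite !inE andbCA.
  rewrite -scaleNr; congr (_ *: _).
  rewrite (vertex_posD1 w vs) (vertex_posD1 v ws) ltvw.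
  have -> : (w < v)%N = false by rewrite ltnNge ltnW.
  by rewrite add0n add1n exprS mulN1r mulNr opprK mulrC.
have -> : \sum_(v in s) \sum_(w in s :\ v) F v w =
    \sum_(v in s) \sum_(w in s | (v < w)%N) F v w +
    \sum_(v in s) \sum_(w in s | (w < v)%N) F v w.
  rewrite -big_split; apply: eq_bigr => v vs /=.
  rewrite (bigID (fun w : 'I_n => (v < w)%N)) /=; congr (_ + _);
    apply: eq_bigl => w; rewrite !inE -val_eqE /=; case: (w \in s);
    by rewrite ?andbF // !andbT; case: ltngtP.
have -> : \sum_(v in s) \sum_(w in s | (w < v)%N) F v w =
    \sum_(v in s) \sum_(w in s | (v < w)%N) F w v.
  rewrite (exchange_big_dep (fun w => w \in s)) /=; last by move=> v w _ /andP[].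
  by apply: eq_bigr => v vs; apply: eq_bigl => w; rewrite vs.
rewrite -big_split big1 //= => v vs; rewrite -big_split big1 //=.
by move=> w /andP[ws ltvw]; rewrite anti ?addNr.
Qed.

Lemma boundaries_sub_cycles D i : simplicial_complex D ->
  (boundaries D i <= cycles D i)%VS.
Proof.
move=> cD; rewrite /boundaries /chains limg_span; apply/span_subvP => c.
case/mapP=> c' /imageP[s /andP[sD /eqP card_s] ->] ->; rewrite lfunE /= boundaryE.
rewrite memv_cap memv_ker lfunE /= boundaryK eqxx andbT.
apply: rpred_sum => v vs; apply/rpredZ/memv_span/imageP; exists (s :\ v) => //.
rewrite inE /= (cD s) ?subsetDl //=.
by move: card_s; rewrite (cardsD1 v) vs PoszD addrC => /addIr->.
Qed.

(* Dimension of the quotient of [cycles D i] by its subspace [boundaries D i]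
   (see [boundaries_sub_cycles]). *)
Definition dim_reduced_homology (D : {set {set 'I_n}}) (i : int) : nat :=
  (\dim (cycles D i) - \dim (boundaries D i))%N.

End Homology.

(* A monomial is represented by its exponent vector in ['X_{1..n}], written
   additively; divisibility is the pointwise order [(_ <= _)%MM]. *)

Definition generated_ideal (k : fieldType) (n : nat) (A : 'X_{1..n} -> Prop)
    (p : {mpoly k[n]}) : Prop :=
  exists2 r : seq ({mpoly k[n]} * 'X_{1..n}),
    (forall x, x \in r -> A x.2) & p = \sum_(x <- r) x.1 * 'X_[x.2].

Definition generates (k : fieldType) (n : nat) (A : 'X_{1..n} -> Prop)
    (I : {mpoly k[n]} -> Prop) : Prop :=
  forall p, I p <-> generated_ideal A p.

Definition monomial_ideal (k : fieldType) (n : nat)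
    (I : {mpoly k[n]} -> Prop) : Prop :=
  exists A : 'X_{1..n} -> Prop, generates A I.

Definition minimal_generating_set (k : fieldType) (n : nat)
    (I : {mpoly k[n]} -> Prop) (G : 'X_{1..n} -> Prop) : Prop :=
  generates G I /\
  forall G' : 'X_{1..n} -> Prop,
    (forall u, G' u -> G u) -> generates G' I -> forall u, G u -> G' u.

(* The set G(I): a monomial ideal has exactly one minimal monomial generating
   set. *)
Definition mingens (k : fieldType) (n : nat) (I : {mpoly k[n]} -> Prop)
    (u : 'X_{1..n}) : Prop :=
  exists2 G, minimal_generating_set I G & G u.

Definition full_support (k : fieldType) (n : nat)
    (I : {mpoly k[n]} -> Prop) : Prop :=
  forall i : 'I_n, exists2 u, mingens I u & (U_(i) <= u)%MM.

Definition is_lcm (n : nat) (A : 'X_{1..n} -> Prop) (a : 'X_{1..n}) : Prop :=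
  (forall u, A u -> (u <= a)%MM) /\
  (forall b, (forall u, A u -> (u <= b)%MM) -> (a <= b)%MM).

Definition xset (n : nat) (s : {set 'I_n}) : 'X_{1..n} :=
  (\sum_(i in s) U_(i))%MM.

Definition IK (k : fieldType) (n : nat) (D : {set {set 'I_n}}) :
    {mpoly k[n]} -> Prop :=
  generated_ideal (fun u => exists2 s, facet D s & u = xset (~: s)).
Arguments IK k {n} D _.

Definition koszul_complex (k : fieldType) (m : nat) (J : {mpoly k[m]} -> Prop)
    (mu : 'X_{1..m}) : {set {set 'I_m}} :=
  [set s : {set 'I_m} | (xset s <= mu)%MM && `[< J 'X_[mu - xset s] >]].

(* The pair of [i] and [j : 'I_(a i)] stands for the variable x_{i, j+1}; the
   variables of P(S) are numbered by [enum_rank]. *)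
Definition polvar (m : nat) (a : 'X_{1..m}) : finType :=
  {i : 'I_m & 'I_(a i)}.

Definition polarize_mon (m : nat) (a u : 'X_{1..m}) :
    'X_{1..#|polvar a|} :=
  (\sum_(x : polvar a | (tagged x < u (tag x))%N) U_(enum_rank x))%MM.

(* [a] is meant to be the lcm of G(J). *)
Definition polarization (k : fieldType) (m : nat) (J : {mpoly k[m]} -> Prop)
    (a : 'X_{1..m}) : {mpoly k[#|polvar a|]} -> Prop :=
  generated_ideal (fun v => exists2 u, mingens J u & v = polarize_mon a u).
Arguments polarization {k m} J a _.

Definition rename_mon (n N : nat) (phi : 'I_n -> 'I_N) (u : 'X_{1..n}) :
    'X_{1..N} :=
  (\sum_(i < n) U_(phi i) *+ u i)%MM.

Definition depolarization (k : fieldType) (n m : nat)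
    (I : {mpoly k[n]} -> Prop) (J : {mpoly k[m]} -> Prop) : Prop :=
  monomial_ideal J /\
  exists2 a : 'X_{1..m}, is_lcm (mingens J) a &
  exists2 phi : 'I_n -> 'I_#|polvar a|, bijective phi &
  forall v, mingens (polarization J a) v <->
            exists2 u, mingens I u & v = rename_mon phi u.

(* Main.v *)
Require Import Defs.
From HB Require Import structures.
From mathcomp Require Import all_boot all_order all_algebra.
From mathcomp Require Import boolp zify.

(** Write J for the depolarization, with lcm [x^mu] of its generators, and
    identify the vertices of [Delta] with the variables [x_(j, l)] of P(J),
    where [1 <= l <= mu_j].  A set of vertices is a face of [Delta] iff some
    generator of the ideal of [Delta] avoids it.  Since these generators are the
    polarizations of the generators u of J ([mingens_polarization]), a set is a
    face iff for some u all its vertices [x_(j, l)] satisfy [u_j < l].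

    This condition weakens as l grows, with j fixed.  Hence if [x_(j, l)] lies
    in a face, adding the last copy [x_(j, mu_j)] gives a face again: each vertex
    is dominated by the last copy of the same variable.  Deleting a dominated
    vertex does not change homology ([dim_homology_del_dominated]), so [Delta] has the
    homology of its subcomplex induced on the last copies
    ([dim_homology_induced]).

    In that subcomplex the faces are the sets of [x_(j, mu_j)] for which some u
    has [u_j < mu_j] for all j involved.  Forgetting the second index, which is
    injective on last copies, gives exactly the Koszul complex of J at [mu]
    ([mem_koszul_lcm]), and an injective relabelling of the vertices preserves
    homology ([dim_homology_relabel]). *)

Set Implicit Arguments.
Unset Strict Implicit.
Unset Printing Implicit Defensive.

Import GRing.Theory.
Local Open Scope ring_scope.

(** * Chains and deformation retracts *)

Section LinearExtension.
Variables (k : fieldType) (n m : nat).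

Definition linext (f : {set 'I_n} -> chain k m) (c : chain k n) : chain k m :=
  \sum_s c s *: f s.

Fact linext_is_linear f : linear (linext f).
Proof.
move=> a u v; rewrite /linext scaler_sumr -big_split /=; apply: eq_bigr => s _.
by rewrite !ffunE scalerDl scalerA.
Qed.

HB.instance Definition _ f :=
  GRing.isLinear.Build k (chain k n) (chain k m) *:%R (linext f)
    (linext_is_linear f).

Lemma linext_simplex f s : linext f (simplex k s) = f s.
Proof.
rewrite /linext (bigD1 s) //= ffunE eqxx scale1r big1 ?addr0 // => t.
by rewrite ffunE => /negPf->; rewrite scale0r.
Qed.

End LinearExtension.

Section Chains.
Variables (k : fieldType) (n : nat).
Implicit Types (D E : {set {set 'I_n}}) (c : chain k n) (s t : {set 'I_n}).
Implicit Types (i j : int).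

Lemma chain_sum c : c = \sum_s c s *: simplex k s.
Proof.
apply/ffunP => t; rewrite sum_ffunE (bigD1 t) //= !ffunE eqxx [_ *: _]mulr1.
rewrite big1 ?addr0 // => s /negPf st; rewrite !ffunE eq_sym st; exact: mulr0.
Qed.

Lemma chainsP D i c :
  reflect (forall s, c s != 0 -> s \in D /\ #|s|%:Z = i + 1)
    (c \in chains k D i).
Proof.
apply: (iffP idP) => [cD s|cD].
  apply: contraNP => /not_andP sD; move: cD; rewrite /chains.
  move/coord_span ->; rewrite sum_ffunE big1 // => j _.
  have /mapP[u] : [seq simplex k s | s in [pred s in D | #|s|%:Z == i + 1]]`_j
      \in [seq simplex k s | s in [pred s in D | #|s|%:Z == i + 1]].
    by apply: mem_nth; rewrite size_map -cardE.
  rewrite mem_enum => /andP[uD /eqP cu] ->; rewrite !ffunE.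
  case: eqP => [su|_]; last exact: mulr0.
  by case: sD; rewrite su // uD.
rewrite [c]chain_sum; apply: rpred_sum => s _.
have [->|/cD[sD cs]] := eqVneq (c s) 0; first by rewrite scale0r rpred0.
by apply/rpredZ/memv_span/imageP; exists s; rewrite // inE /= sD cs eqxx.
Qed.

Lemma simplex_chains D i s :
  s \in D -> #|s|%:Z = i + 1 -> simplex k s \in chains k D i.
Proof.
move=> sD cs; apply/chainsP => t; rewrite ffunE.
by have [->|_] := eqVneq t s; rewrite ?eqxx.
Qed.

Lemma linext_chains m (E : {set {set 'I_m}}) D i j
    (f : {set 'I_n} -> chain k m) c :
  (forall s, s \in D -> #|s|%:Z = i + 1 -> f s \in chains k E j) ->
  c \in chains k D i -> linext f c \in chains k E j.
Proof.
move=> fE /chainsP cD; apply: rpred_sum => s _.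
have [->|/cD[sD cs]] := eqVneq (c s) 0; first by rewrite scale0r rpred0.
exact/rpredZ/fE.
Qed.

Lemma boundary_chains D i c : simplicial_complex D ->
  c \in chains k D (i + 1) -> boundary c \in chains k D i.
Proof.
move=> cxD; apply: linext_chains => s sD cs.
apply: rpred_sum => v vs; apply/rpredZ/simplex_chains.
  exact: cxD sD (subsetDl _ _).
by move: cs; rewrite (cardsD1 v) vs PoszD addrC => /addIr.
Qed.

Lemma boundary_boundary c : boundary (boundary c) = 0.
Proof.
rewrite {2}/boundary linear_sum big1 //= => s _.
by rewrite linearZ /= boundaryK scaler0.
Qed.

Lemma cyclesP D i c :
  reflect (c \in chains k D i /\ boundary c = 0) (c \in cycles k D i).
Proof.
rewrite memv_cap memv_ker lfunE /=.
by apply: (iffP andP) => -[? /eqP].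
Qed.

Lemma boundariesP D i c :
  reflect (exists2 d, d \in chains k D (i + 1) & c = boundary d)
    (c \in boundaries k D i).
Proof.
by apply: (iffP memv_imgP) => -[d dD ->]; exists d => //; rewrite lfunE.
Qed.

Lemma chains_sub D E i : D \subset E -> (chains k D i <= chains k E i)%VS.
Proof.
move=> /subsetP DE; apply/subvP => c /chainsP cD; apply/chainsP => s /cD[sD ->].
by rewrite DE.
Qed.

(** The map [c |-> c - boundary (h c) - h (boundary c)] is a chain map homotopic
    to the identity, so a retraction of this form onto the subcomplex [E] makes
    the inclusion of [E] a homotopy equivalence.  On dimensions this is read off
    from [Z_E + B_D = Z_D] (surjectivity on homology) and
    [Z_E :&: B_D = B_E] (injectivity). *)
Lemma dim_homology_retract D E (h : {linear chain k n -> chain k n}) :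
  simplicial_complex D -> simplicial_complex E -> E \subset D ->
  (forall i c, c \in chains k D i -> h c \in chains k D (i + 1)) ->
  (forall i c, c \in chains k E i -> h c = 0) ->
  (forall i c, c \in chains k D i ->
     c - boundary (h c) - h (boundary c) \in chains k E i) ->
  forall i : int, dim_reduced_homology k D i = dim_reduced_homology k E i.
Proof.
move=> cxD cxE ED hD hE retr i.
have subC := subvP (chains_sub _ ED).
have BZ := boundaries_sub_cycles k i cxD.
have BZ' := boundaries_sub_cycles k i cxE.
have addZ : (cycles k E i + boundaries k D i = cycles k D i)%VS.
  apply/eqP; rewrite eqEsubv subv_add BZ andbT; apply/andP; split.
    apply/subvP => c /cyclesP[cE bc]; apply/cyclesP; split => //; exact: subC.
  apply/subvP => z /cyclesP[zD bz]; rewrite -(subrK (boundary (h z)) z).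
  apply: memv_add; last by apply/boundariesP; exists (h z) => //; exact: hD.
  apply/cyclesP; split; last by rewrite linearB /= boundary_boundary bz subr0.
  by have := retr _ _ zD; rewrite bz linear0 subr0.
have capZ : (cycles k E i :&: boundaries k D i = boundaries k E i)%VS.
  apply/eqP; rewrite eqEsubv subv_cap BZ' /=; apply/andP; split; last first.
    apply/subvP => z /boundariesP[c cE ->]; apply/boundariesP.
    by exists c => //; exact: subC.
  apply/subvP => z; rewrite memv_cap => /andP[/cyclesP[zE _]].
  move=> /boundariesP[c cD zc]; apply/boundariesP.
  exists (c - boundary (h c) - h (boundary c)); first exact: retr.
  by rewrite -zc (hE _ _ zE) subr0 linearB /= boundary_boundary subr0.
have := dimv_sum_cap (cycles k E i) (boundaries k D i).
rewrite addZ capZ /dim_reduced_homology.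
by have := dimvS BZ; have := dimvS BZ'; lia.
Qed.

End Chains.

(** * Deleting a dominated vertex *)

Section DominatedVertex.
Variables (k : fieldType) (n : nat) (v w : 'I_n).
Hypothesis neq_vw : v != w.
Implicit Types (D E : {set {set 'I_n}}) (s t : {set 'I_n}).

(** Coning off with apex [w], but only the simplices through [v].  For an
    oriented simplex [v, x, y, ...] the homotopy formula with this [h] yields
    [w, x, y, ...]: up to homotopy, [v] is replaced by [w]. *)
Definition cone_simplex s : chain k n :=
  if (v \in s) && (w \notin s)
  then (-1) ^+ vertex_pos (w |: s) w *: simplex k (w |: s) else 0.

(** Modulo simplices avoiding [v], this is the usual contraction of a cone: [w]
    is an apex for the simplices through [v].  The facet opposite to [v] is not
    coned off, which leaves a term without [v], invisible at [t]. *)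
Lemma cone_homotopy s t : v \in t ->
  (boundary (cone_simplex s) + linext cone_simplex (boundary_simplex k s)) t =
  simplex k s t.
Proof.
move=> vt; rewrite linear_sum /=.
under eq_bigr => u us do rewrite linearZ /= linext_simplex.
have [vs|vs] := boolP (v \in s); last first.
  rewrite {1}/cone_simplex (negPf vs) /= linear0 add0r big1 => [|u us].
    by rewrite !ffunE; case: eqP => // ts; rewrite -ts vt in vs.
  by rewrite /cone_simplex !inE (negPf vs) andbF /= scaler0.
have [ws|ws] := boolP (w \in s).
  (* Only the facet opposite to [w] is coned off, and its cone is [s] again. *)
  rewrite {1}/cone_simplex ws andbF linear0 add0r (bigD1 w) //= big1 ?addr0.
    rewrite /cone_simplex !inE eqxx neq_vw vs /= setD1K // scalerA.
    by rewrite -expr2 sqrr_sign scale1r.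
  move=> u /andP[us uw].
  by rewrite /cone_simplex !inE ws (eq_sym w) uw andbF scaler0.
(* The facet of the cone opposite to [w] is [s]; for [u] in [s] other than [v],
   the facet opposite to [u] cancels against the cone over [s :\ u]. *)
rewrite {1}/cone_simplex vs ws /= linearZ /= boundaryE /boundary_simplex.
rewrite big_setU1 //= scalerDr scalerA -expr2 sqrr_sign scale1r setU1K //.
rewrite -addrA scaler_sumr -big_split /= (bigD1 v) //= big1 => [|u /andP[us uv]].
  rewrite /cone_simplex !inE eqxx /= scaler0 addr0 addr0 !ffunE.
  case: (t =P (w |: s) :\ v) => [E|_]; last by rewrite scaler0 scaler0 addr0.
  by move: vt; rewrite E !inE eqxx.
have uw : u != w by apply: contraNneq ws => <-.
rewrite /cone_simplex !inE eq_sym uv vs (negPf ws) andbF /= !scalerA.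
have E : (w |: s) :\ u = w |: (s :\ u).
  by apply/setP => x; rewrite !inE; case: (x =P w) => // ->; rewrite eq_sym uw.
rewrite E -scalerDl (@vertex_posD1 _ (w |: s) u w) ?inE ?us ?orbT //.
rewrite (@vertex_posD1 _ (w |: s) w u) ?inE ?eqxx // setU1K // E.
rewrite !exprD mulrACA -exprD.
have -> : ((u < w) + (w < u) = 1)%N.
  by move: uw; rewrite -val_eqE /=; case: ltngtP.
by rewrite expr1 mulN1r mulrC addNr scale0r.
Qed.

(** The link of a dominated vertex is a cone, so deleting the vertex is a
    homotopy equivalence; the hypothesis keeps the partial cone inside [D]. *)
Lemma dim_homology_del_dominated D : simplicial_complex D ->
  (forall s, s \in D -> v \in s -> w |: s \in D) ->
  forall i : int, dim_reduced_homology k D i =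
    dim_reduced_homology k [set s in D | v \notin s] i.
Proof.
move=> cxD dom; set E := [set s in D | v \notin s].
have cxE : simplicial_complex E.
  move=> s t; rewrite !inE => /andP[sD vs] ts; rewrite (cxD s) //=.
  exact: contra (subsetP ts v) vs.
have hD (i : int) c : c \in chains k D i ->
    linext cone_simplex c \in chains k D (i + 1).
  apply: linext_chains => s sD cs; rewrite /cone_simplex.
  case: ifP => [/andP[vs ws]|_]; last exact: rpred0.
  apply/rpredZ/simplex_chains; first exact: dom.
  by rewrite cardsU1 ws PoszD cs addrC.
apply: (@dim_homology_retract _ _ _ _ (linext cone_simplex)) => //.
- by apply/subsetP => s; rewrite inE => /andP[].
- move=> i c /chainsP cE; rewrite /= /linext big1 // => s _.
  have [->|/cE[]] := eqVneq (c s) 0; first by rewrite scale0r.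
  by rewrite inE => /andP[_ /negPf vs] _; rewrite /cone_simplex vs scaler0.
move=> i c cD; apply/chainsP => t.
rewrite -addrA -opprD /= => ct.
have bhc : boundary (linext cone_simplex c) \in chains k D i.
  exact/boundary_chains/hD.
have hbc : linext cone_simplex (boundary c) \in chains k D i.
  rewrite -(subrK 1 i); by apply/hD/boundary_chains; rewrite ?subrK.
have /chainsP/(_ t ct)[tD ->] := rpredB cD (rpredD bhc hbc).
split=> //; rewrite inE tD; apply: contraNN ct => vt.
have bhE : boundary (linext cone_simplex c) =
    \sum_s c s *: boundary (cone_simplex s).
  by rewrite linear_sum; apply: eq_bigr => s _; rewrite linearZ.
have hbE : linext cone_simplex (boundary c) =
    \sum_s c s *: linext cone_simplex (boundary_simplex k s).
  by rewrite linear_sum; apply: eq_bigr => s _; rewrite linearZ.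
rewrite bhE hbE {1}[c]chain_sum -big_split -sumrB sum_ffunE big1 // => s _ /=.
rewrite -scalerDr -scalerBr ffunE [X in _ *: X]ffunE [X in _ + X]ffunE.
by rewrite cone_homotopy // subrr scaler0.
Qed.

End DominatedVertex.

(** Vertices outside [L] are deleted one at a time; as the dominating vertices
    are taken in [L], they survive all these deletions. *)
Lemma dim_homology_induced (k : fieldType) (n : nat) (D : {set {set 'I_n}})
    (L : {set 'I_n}) (i : int) :
  simplicial_complex D ->
  (forall v, v \notin L ->
     exists2 w, w \in L & forall s, s \in D -> v \in s -> w |: s \in D) ->
  dim_reduced_homology k D i =
  dim_reduced_homology k [set s in D | s \subset L] i.
Proof.
move=> cxD; have [N] := ubnP #|~: L|; elim: N L => // N IHN L; rewrite ltnS.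
move=> leN dom; have [L0|[v]] := set_0Vmem (~: L).
  congr (dim_reduced_homology _ _ _); apply/setP => s.
  by rewrite inE -[L]setCK L0 setC0 subsetT andbT.
rewrite inE => vL; have [w wL domw] := dom v vL.
have -> : dim_reduced_homology k D i =
    dim_reduced_homology k [set s in D | s \subset v |: L] i.
  apply: IHN => [|u].
    have -> : ~: (v |: L) = ~: L :\ v by rewrite setCU setDE setIC.
    by move: leN; rewrite (cardsD1 v (~: L)) inE vL.
  rewrite !inE negb_or => /andP[_ /dom[x xL domx]].
  by exists x; rewrite // !inE xL orbT.
have neq_vw : v != w by apply: contraNneq vL => ->.
rewrite (@dim_homology_del_dominated k n v w neq_vw) => [|s t|s].
- congr (dim_reduced_homology _ _ _); apply/setP => s; rewrite !inE -andbA.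
  congr (_ && _); apply/andP/idP => [[/subsetP sL vs]|sL].
    apply/subsetP => x xs; have := sL x xs; rewrite !inE => /predU1P[xv|//].
    by rewrite -xv xs in vs.
  split; first exact: subset_trans sL (subsetUr _ _).
  by apply: contra vL; exact: (subsetP sL).
- rewrite !inE => /andP[sD sL] ts.
  by rewrite (cxD s) //= (subset_trans ts).
- rewrite !inE => /andP[sD sL] vs; rewrite domw //= subUset sL andbT.
  by rewrite sub1set !inE wL orbT.
Qed.

(** * Relabelling the vertices *)

Lemma vertex_pos_sum N (s : {set 'I_N}) v :
  vertex_pos s v = (\sum_(w in s) (w < v)%N)%N.
Proof.
rewrite /vertex_pos -sum1dep_card big_mkcondr /=.
by apply: eq_bigr => w _; case: ltnP.
Qed.

Section Relabel.
Variables (k : fieldType) (n m : nat) (f : 'I_n -> 'I_m) (L : {set 'I_n}).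
Hypothesis injf : {in L &, injective f}.
Implicit Types (D : {set {set 'I_n}}) (s t : {set 'I_n}).

Definition inversions s : nat :=
  (\sum_(x in s) \sum_(y in s) ((x < y) && (f y < f x)))%N.

Let injs s : s \subset L -> {in s &, injective f}.
Proof. by move=> /subsetP sL x y /sL xL /sL yL; exact: injf. Qed.

Lemma imset_sub_inj s t :
  s \subset L -> t \subset L -> f @: s = f @: t -> s = t.
Proof.
have sub s1 s2 : s1 \subset L -> s2 \subset L -> f @: s1 = f @: s2 ->
    s1 \subset s2.
  move=> /subsetP L1 /subsetP L2 E; apply/subsetP => x xs.
  have /imsetP[y ys fxy] : f x \in f @: s2 by rewrite -E imset_f.
  by rewrite (injf (L1 _ xs) (L2 _ ys) fxy).
by move=> sL tL E; apply/eqP; rewrite eqEsubset; apply/andP; split; exact: sub.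
Qed.

Lemma vertex_pos_imset s v : s \subset L -> v \in s ->
  vertex_pos (f @: s) (f v) = (\sum_(w in s) (f w < f v)%N)%N.
Proof.
by move=> sL vs; rewrite vertex_pos_sum big_imset //; exact: injs.
Qed.

(** Both sides are the sign of the same reordering: [v] can be moved to the front
    before or after sorting the images of the remaining vertices. *)
Lemma inversions_sign s v : s \subset L -> v \in s ->
  (-1) ^+ inversions s * (-1) ^+ vertex_pos (f @: s) (f v) =
  (-1) ^+ vertex_pos s v * (-1) ^+ inversions (s :\ v) :> k.
Proof.
move=> sL vs; rewrite -!exprD -[LHS]signr_odd -[RHS]signr_odd; congr (_ ^+ _).
congr nat_of_bool; rewrite vertex_pos_imset // vertex_pos_sum.
rewrite [inversions s](big_setD1 v) //=.
under [X in (_ + X + _)%N]eq_bigr => x _ do rewrite (big_setD1 v) //=.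
rewrite big_split /= -/(inversions (s :\ v)) !(big_setD1 v vs) /= !ltnn !add0n.
set I := inversions _.
(* [B] counts the [w] after [v] whose order with [v] is reversed by [f]: they
   contribute both to the inversions of [s] and to the new position of [v]. *)
pose B := (\sum_(w in s :\ v) ((v < w) && (f w < f v))%N)%N.
have E : (\sum_(w in s :\ v) ((w < v) && (f v < f w)) +
   \sum_(w in s :\ v) (f w < f v) = B + \sum_(w in s :\ v) (w < v))%N.
  rewrite -!big_split /=; apply: eq_bigr => w; rewrite !inE => /andP[wv ws].
  have fwv : f w != f v by apply: contraNneq wv => /(injs sL)->.
  move: wv fwv; rewrite -!val_eqE /=.
  by case: (ltngtP w v) => // _ _; case: (ltngtP (f w) (f v)).
rewrite -/B -addnA [(_ + I + _)%N]addnAC E !addnA addnn -addnA.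
by rewrite oddD odd_double.
Qed.

(** The sign of the permutation that sorts the images turns the bijection of
    simplices into a chain map, [f] being possibly not monotone. *)
Definition relabel_simplex s : chain k m :=
  (-1) ^+ inversions s *: simplex k (f @: s).

Lemma boundary_relabel_simplex s : s \subset L ->
  boundary (relabel_simplex s) = linext relabel_simplex (boundary_simplex k s).
Proof.
move=> sL; rewrite linearZ /= boundaryE /boundary_simplex.
rewrite big_imset /=; last exact: injs.
rewrite scaler_sumr [RHS]linear_sum /=; apply: eq_bigr => v vs.
rewrite [RHS]linearZ /= linext_simplex !scalerA inversions_sign //.
congr (_ *: simplex _ _); apply/setP => u; rewrite !inE.
apply/andP/imsetP => [[uv /imsetP[x xs ux]]|[x]].
  by exists x; rewrite // !inE xs andbT; apply: contraNneq uv => <-; rewrite ux.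
rewrite !inE => /andP[xv xs] ->; rewrite imset_f //; split => //.
by apply: contraNneq xv => /(injs sL)->.
Qed.

(** Relabelling is an isomorphism of chain complexes from [D] onto its image, and
    isomorphisms preserve the dimensions of cycles and of boundaries. *)
Lemma dim_homology_relabel D (i : int) : simplicial_complex D ->
  (forall s, s \in D -> s \subset L) ->
  dim_reduced_homology k D i =
  dim_reduced_homology k [set f @: (s : {set 'I_n}) | s in D] i.
Proof.
move=> cxD DL; set E := [set f @: (s : {set 'I_n}) | s in D].
pose F := linext relabel_simplex.
have cardf s : s \in D -> #|f @: s| = #|s|.
  by move=> sD; rewrite card_in_imset //; exact/injs/DL.
have FE (j : int) c : c \in chains k D j -> F c \in chains k E j.
  apply: linext_chains => s sD cs; apply/rpredZ/simplex_chains.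
    exact: imset_f.
  by rewrite cardf.
have Fonto (j : int) d : d \in chains k E j ->
    exists2 c, c \in chains k D j & d = F c.
  move=> dE; suff /memv_imgP[c cD ->] : d \in (linfun F @: chains k D j)%VS.
    by exists c; rewrite ?lfunE.
  rewrite [d]chain_sum; apply: rpred_sum => u _.
  have [->|/(chainsP _ _ _ dE)[]] := eqVneq (d u) 0.
    by rewrite scale0r rpred0.
  move=> /imsetP[s sD ->]; rewrite cardf // => cs; apply: rpredZ.
  have -> : simplex k (f @: s) =
      linfun F ((-1) ^+ inversions s *: simplex k s).
    rewrite lfunE linearZ /= /F linext_simplex scalerA -expr2 sqrr_sign.
    by rewrite scale1r.
  exact/memv_img/rpredZ/simplex_chains.
have Finj (j : int) c : c \in chains k D j -> F c = 0 -> c = 0.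
  move=> /chainsP cD Fc; apply/ffunP => s; rewrite [RHS]ffunE; apply/eqP.
  apply/contraPT: Fc => cs; have [sD _] := cD s cs.
  move=> /ffunP/(_ (f @: s)); rewrite sum_ffunE (bigD1 s) //= big1 ?addr0.
    rewrite !ffunE eqxx => /eqP; rewrite !mulf_eq0 signr_eq0 (negPf cs).
    by rewrite oner_eq0.
  move=> t ts; have [->|/cD[tD _]] := eqVneq (c t) 0.
    by rewrite scale0r ffunE.
  rewrite !ffunE; case: eqP => [ft|_]; last by rewrite !scaler0.
  by case/eqP: ts; apply: imset_sub_inj; rewrite ?DL.
have bF (j : int) c : c \in chains k D j -> boundary (F c) = F (boundary c).
  move=> /chainsP cD.
  have -> : boundary (F c) = \sum_s c s *: boundary (relabel_simplex s).
    by rewrite linear_sum; apply: eq_bigr => s _; rewrite linearZ.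
  rewrite [RHS]linear_sum; apply: eq_bigr => s _; rewrite [RHS]linearZ /=.
  have [->|/cD[/DL sL _]] := eqVneq (c s) 0; first by rewrite !scale0r.
  by rewrite boundary_relabel_simplex.
have dimF (U : {vspace chain k n}) (j : int) :
    (U <= chains k D j)%VS -> \dim (linfun F @: U) = \dim U.
  move=> /subvP UD; apply: limg_dim_eq; apply/eqP; rewrite -subv0.
  apply/subvP => c; rewrite memv_cap memv_ker lfunE /= => /andP[cU /eqP Fc].
  by rewrite memv0 (Finj j c) // UD.
have ZE : (linfun F @: cycles k D i)%VS = cycles k E i.
  apply/eqP; rewrite eqEsubv; apply/andP; split; apply/subvP => z.
    move=> /memv_imgP[c /cyclesP[cD bc] ->]; rewrite lfunE /=.
    by apply/cyclesP; split; [exact: FE|rewrite (bF i) // bc /F linear0].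
  move=> /cyclesP[/Fonto[c cD ->]]; rewrite (bF i) // => Fbc.
  have bc : boundary c = 0.
    by apply: (Finj (i - 1)) Fbc; apply: boundary_chains; rewrite ?subrK.
  by rewrite -[F c]lfunE /=; apply/memv_img/cyclesP.
have BE : (linfun F @: boundaries k D i)%VS = boundaries k E i.
  apply/eqP; rewrite eqEsubv; apply/andP; split; apply/subvP => z.
    move=> /memv_imgP[c /boundariesP[d dD ->] ->]; rewrite lfunE /=.
    by apply/boundariesP; exists (F d); [exact: FE | rewrite (bF (i + 1))].
  move=> /boundariesP[d /Fonto[c cD ->] ->]; rewrite (bF (i + 1)) //.
  by rewrite -[F _]lfunE; apply/memv_img/boundariesP; exists c.
have ZD : (cycles k D i <= chains k D i)%VS := capvSl _ _.
rewrite /dim_reduced_homology -ZE -BE !(dimF _ i) //.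
exact: subv_trans (boundaries_sub_cycles k i cxD) ZD.
Qed.

End Relabel.

(** * Minimal generators of monomial ideals *)

Section MonomialIdeals.
Variables (k : fieldType) (n : nat).
Implicit Types (A B G : 'X_{1..n} -> Prop) (I : {mpoly k[n]} -> Prop).
Implicit Types (p : {mpoly k[n]}) (u v : 'X_{1..n}).

Lemma lepm_anti u v : (u <= v)%MM -> (v <= u)%MM -> u = v.
Proof.
move=> /mnm_lepP uv /mnm_lepP vu; apply/mnmP => i; apply/eqP.
by rewrite eqn_leq uv vu.
Qed.

(** Cancellation can only remove monomials from a combination of multiples of
    generators, and every term that is left is itself such a multiple. *)
Lemma generated_idealP A p :
  generated_ideal A p <->
  forall u, u \in msupp p -> exists2 v, A v & (v <= u)%MM.
Proof.
split=> [[r rA ->] u|].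
  rewrite mcoeff_msupp raddf_sum /= => nz.
  have [x xr nzx] : exists2 x, x \in r & (x.1 * 'X_[x.2])@_u != 0.
    apply: contrapT => none; case/eqP: nz; rewrite big_seq big1 // => x xr.
    by apply/eqP; apply: contrapT => /negP nzx; apply: none; exists x.
  exists x.2; first exact: rA.
  move: nzx; rewrite -mcoeff_msupp (perm_mem (msuppMX _ _)) => /mapP[v _ ->].
  exact: lem_addr.
rewrite {2}[p]mpolyE; elim: (msupp p) => [|u r IHr] pA.
  by exists [::]; rewrite // !big_nil.
have [q qA qE] := IHr (fun v vr => pA v (mem_behead (s := u :: r) vr)).
have [v Av vu] := pA u (mem_head u r).
exists ((p@_u *: 'X_[u - v], v) :: q) => [x|].
  by rewrite inE => /predU1P[->|/qA].
by rewrite !big_cons qE /= -scalerAl -mpolyXD submK.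
Qed.

Lemma generated_ideal_mon A u :
  generated_ideal A ('X_[u] : {mpoly k[n]}) <-> exists2 v, A v & (v <= u)%MM.
Proof.
rewrite generated_idealP; split=> [/(_ u)|[v Av vu] w]; rewrite msuppX inE.
  by apply.
by move=> /eqP ->; exists v.
Qed.

(** Divisibility is well founded, as a proper divisor has smaller degree. *)
Lemma exists_minimal_below A u : A u ->
  exists2 v, A v /\ (forall w, A w -> (w <= v)%MM -> w = v) & (v <= u)%MM.
Proof.
have [N] := ubnP (mdeg u); elim: N u => // N IHN u; rewrite ltnS => uN Au.
have [min|] := pselect (forall w, A w -> (w <= u)%MM -> w = u).
  by exists u; rewrite // lepm_refl.
move=> /existsNP[w /not_implyP[Aw /not_implyP[wu neq_wu]]].
have [|v minv vw] := IHN w _ Aw; last first.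
  by exists v => //; exact: lepm_trans wu.
apply: leq_trans uN; rewrite -(submK wu) mdegD -[X in (X < _)%N]add0n ltn_add2r.
rewrite lt0n mdeg_eq0; apply/eqP => uw0; apply: neq_wu.
by rewrite -[RHS](submK wu) uw0 add0m.
Qed.

(** The set G(I) without quantification over generating sets: the monomials of
    [I] that are minimal for divisibility. *)
Definition minimal_monomial I u : Prop :=
  I 'X_[u] /\ forall v, I 'X_[v] -> (v <= u)%MM -> v = u.

Lemma generates_minimal_monomial I :
  monomial_ideal I -> generates (minimal_monomial I) I.
Proof.
move=> [A genA] p; rewrite genA !generated_idealP.
have IA u : I 'X_[u] <-> exists2 v, A v & (v <= u)%MM.
  by rewrite genA generated_ideal_mon.
split=> pA u /pA[v].
  move=> Av vu; have : I 'X_[v] by apply/IA; exists v; rewrite ?lepm_refl.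
  move=> /(@exists_minimal_below (fun u => I 'X_[u]))[w minw wv].
  by exists w => //; exact: lepm_trans vu.
move=> [/IA[w Aw wv] _] vu; exists w => //; exact: lepm_trans vu.
Qed.

Lemma minimal_monomial_in_generators I G u :
  generates G I -> minimal_monomial I u -> G u.
Proof.
move=> genG [/genG/generated_ideal_mon[v Gv vu] minu].
rewrite -(minu v) //; apply/genG/generated_ideal_mon.
by exists v; rewrite ?lepm_refl.
Qed.

(** Minimal monomials generate [I] and lie in every generating set, so they form
    its only minimal generating set. *)
Lemma mingensP I u :
  monomial_ideal I -> mingens I u <-> minimal_monomial I u.
Proof.
move=> monI; have genM := generates_minimal_monomial monI.
split=> [[G [genG minG] Gu]|minu].
  apply: minG genM _ Gu => v; exact: minimal_monomial_in_generators.
exists (minimal_monomial I) => //; split=> // G _ genG v.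
exact: minimal_monomial_in_generators.
Qed.

Lemma monomial_ideal_mon I u : monomial_ideal I ->
  I 'X_[u] <-> exists2 v, mingens I v & (v <= u)%MM.
Proof.
move=> monI; rewrite (generates_minimal_monomial monI) generated_ideal_mon.
by split=> -[v vI vu]; exists v => //; apply/mingensP.
Qed.

Lemma mingens_generated_antichain A u :
  (forall v w, A v -> A w -> (v <= w)%MM -> v = w) ->
  mingens (@generated_ideal k n A) u <-> A u.
Proof.
move=> anti.
have genA : generates A (@generated_ideal k n A) by [].
rewrite mingensP; last by exists A.
split=> [|Au]; first exact: minimal_monomial_in_generators.
split=> [|v]; first by apply/generated_ideal_mon; exists u; rewrite ?lepm_refl.
move=> /generated_ideal_mon[w Aw wv] vu.
have wu := anti _ _ Aw Au (lepm_trans wv vu).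
by apply: lepm_anti => //; rewrite -wu.
Qed.

Lemma mingens_antichain I u v : monomial_ideal I ->
  mingens I u -> mingens I v -> (u <= v)%MM -> u = v.
Proof. by move=> monI /mingensP[]// Iu _ /mingensP[]// _; exact. Qed.

End MonomialIdeals.

(** * Squarefree monomials, polarization and renaming *)

Lemma mnm_sumU_inj (I : finType) N (P : pred I) (F : I -> 'I_N) j :
  injective F -> (\sum_(i | P i) U_(F i))%MM (F j) = P j.
Proof.
move=> injF; rewrite mnm_sumE big_mkcond (bigD1 j) //= big1 => [|i ij].
  by rewrite mnm1E eqxx; case: (P j).
by rewrite mnm1E (inj_eq injF) (negPf ij); case: (P i).
Qed.

Lemma xsetE n (s : {set 'I_n}) i : xset s i = (i \in s).
Proof. exact: (mnm_sumU_inj (mem s) i (@inj_id _)). Qed.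

Lemma polarize_monE m (a u : 'X_{1..m}) (x : polvar a) :
  polarize_mon a u (enum_rank x) = (tagged x < u (tag x))%N.
Proof. exact: mnm_sumU_inj enum_rank_inj. Qed.

Lemma rename_monE n N (phi : 'I_n -> 'I_N) (u : 'X_{1..n}) i :
  injective phi -> rename_mon phi u (phi i) = u i.
Proof.
move=> injphi; rewrite /rename_mon mnm_sumE (bigD1 i) //= big1 => [|j ji].
  by rewrite mulmnE mnm1E eqxx mul1n addn0.
by rewrite mulmnE mnm1E (inj_eq injphi) (negPf ji).
Qed.

(** A failure [v i < u i] is witnessed by the variable [x_(i, v i + 1)], which
    exists because [u i <= a i]. *)
Lemma polarize_mon_le m (a u v : 'X_{1..m}) : (u <= a)%MM ->
  (polarize_mon a u <= polarize_mon a v)%MM -> (u <= v)%MM.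
Proof.
move=> /mnm_lepP ua /mnm_lepP uv; apply/mnm_lepP => i.
rewrite leqNgt; apply/negP => vu.
pose x : polvar a := Tagged (fun i => 'I_(a i)) (Ordinal (leq_trans vu (ua i))).
by have := uv (enum_rank x); rewrite !polarize_monE /= vu ltnn.
Qed.

(** * Faces in terms of generators *)

Section Faces.
Variable k : fieldType.

(** Facets are pairwise incomparable, hence so are their complements. *)
Lemma mingens_IK n (Delta : {set {set 'I_n}}) u :
  mingens (IK k Delta) u <-> exists2 s, facet Delta s & u = xset (~: s).
Proof.
apply: mingens_generated_antichain => _ _ [s /maxsetP[sD _] ->] [t maxt ->].
case/maxsetP: maxt => _ maxt /mnm_lepP le_st; rewrite (maxt s) //.
apply/subsetP => i; apply: contraLR => it.
by have := le_st i; rewrite !xsetE !inE it; case: (i \in t).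
Qed.

(** [Delta] is the Koszul complex of its ideal at the all-ones multidegree. *)
Lemma mem_complex_IK n (Delta : {set {set 'I_n}}) (t : {set 'I_n}) :
  simplicial_complex Delta ->
  t \in Delta <->
  exists2 u, mingens (IK k Delta) u & forall v, v \in t -> u v = 0%N.
Proof.
move=> cxD; split=> [tD|[u /mingens_IK[s /maxsetP[sD _] ->] u0]].
  have [s maxs ts] := @maxset_exists _ [pred t | t \in Delta] _ tD.
  exists (xset (~: s)); first by apply/mingens_IK; exists s.
  by move=> v /(subsetP ts) vs; rewrite xsetE inE vs.
apply: cxD sD _; apply/subsetP => v /u0; rewrite xsetE inE.
by case: (v \in s).
Qed.

Variables (m : nat) (J : {mpoly k[m]} -> Prop) (a : 'X_{1..m}).
Hypothesis monJ : monomial_ideal J.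
Hypothesis leJa : forall u, mingens J u -> (u <= a)%MM.

Lemma mingens_polarization v :
  mingens (polarization J a) v <->
  exists2 u, mingens J u & v = polarize_mon a u.
Proof.
apply: mingens_generated_antichain => _ _ [u Ju ->] [w Jw ->] le_uw.
congr polarize_mon; apply: (mingens_antichain monJ Ju Jw).
exact: polarize_mon_le (leJa Ju) le_uw.
Qed.

(** At the top multidegree [a], dividing by [x_i] costs nothing to a generator
    that does not attain the maximal exponent of [x_i]. *)
Lemma mem_koszul_lcm (s : {set 'I_m}) :
  s \in koszul_complex J a <->
  exists2 u, mingens J u & forall i, i \in s -> (u i < a i)%N.
Proof.
rewrite inE; split=> [/andP[/mnm_lepP sa /asboolP]|[u Ju ua]].
  move=> /(monomial_ideal_mon _ monJ)[u Ju /mnm_lepP us]; exists u => // i si.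
  by have := us i; have := sa i; rewrite mnmBE xsetE si; lia.
apply/andP; split.
  apply/mnm_lepP => i; rewrite xsetE; have := ua i.
  by case: (i \in s) => //; lia.
apply/asboolP/(monomial_ideal_mon _ monJ); exists u => //; apply/mnm_lepP => i.
rewrite mnmBE xsetE; have := ua i; have /mnm_lepP/(_ i) := leJa Ju.
by case: (i \in s) => [_ /(_ isT)|]; lia.
Qed.

End Faces.

Lemma polvar_eq m (a : 'X_{1..m}) (x y : polvar a) :
  tag x = tag y -> tagged x = tagged y :> nat -> x = y.
Proof.
case: x y => i p [j q] /= eij; case: _ / eij q => q epq.
by congr Tagged; apply: val_inj.
Qed.

Theorem proposition4p4 (k : fieldType) (n : nat) (Delta : {set {set 'I_n}})
    (hDelta : simplicial_complex Delta)
    (hfull : full_support (IK k Delta))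
    (m : nat) (D : {mpoly k[m]} -> Prop)
    (hD : depolarization (IK k Delta) D)
    (mu : 'X_{1..m}) (hmu : is_lcm (mingens D) mu) (i : int) :
  dim_reduced_homology k Delta i =
  dim_reduced_homology k (koszul_complex D mu) i.
Proof.
have [monD [a lcma [phi bij_phi genE]]] := hD.
have {lcma} amu : a = mu.
  by apply: lepm_anti; [apply: lcma.2 hmu.1 | apply: hmu.2 lcma.1].
subst a; have [leDmu _] := hmu; have inj_phi := bij_inj bij_phi.
pose pv v : polvar mu := enum_val (phi v).
have rename_pv u v : rename_mon phi u (enum_rank (pv v)) = u v.
  by rewrite enum_valK rename_monE.
have pv_surj x : exists v, pv v = x.
  have [psi _ psiK] := bij_phi; exists (psi (enum_rank x)).
  by rewrite /pv psiK enum_rankK.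
(* A vertex standing for [x_(j, l + 1)] avoids the polarization of [u] exactly
   when [u j <= l]. *)
have memDelta (t : {set 'I_n}) : t \in Delta <->
    exists2 u, mingens D u &
    forall v, v \in t -> (u (tag (pv v)) <= tagged (pv v))%N.
  rewrite (mem_complex_IK k t hDelta); split=> [[w Iw w0]|[u Du leu]].
    have /genE/(mingens_polarization monD leDmu)[u Du wu] :
      exists2 u, mingens (IK k Delta) u & rename_mon phi w = rename_mon phi u.
      by exists w.
    exists u => // v /w0; rewrite -rename_pv wu polarize_monE leqNgt.
    by case: ltnP.
  have /(mingens_polarization monD leDmu)/genE[w Iw uw] :
    exists2 w, mingens D w & polarize_mon mu u = polarize_mon mu w by exists u.
  exists w => // v /leu; rewrite -rename_pv -uw polarize_monE leqNgt.
  by case: ltnP.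
(* The vertices that correspond to the last copy of each variable. *)
pose L := [set v | (tagged (pv v)).+1 == mu (tag (pv v))].
have last_vertex j : (0 < mu j)%N -> exists2 v, v \in L & tag (pv v) = j.
  move=> mu_gt0; have lt_last : ((mu j).-1 < mu j)%N by rewrite prednK.
  have [v pvE] := pv_surj (Tagged (fun j => 'I_(mu j)) (Ordinal lt_last)).
  by exists v; rewrite ?inE pvE //= prednK.
rewrite (@dim_homology_induced k n Delta L i hDelta) => [|v vL]; last first.
  (* Later copies divide fewer polarized generators: the last copy of a
     variable dominates all the others. *)
  have lt0mu := leq_ltn_trans (leq0n _) (ltn_ord (tagged (pv v))).
  have [w wL wv] := last_vertex _ lt0mu.
  exists w => // s /memDelta[u Du leu] vs; apply/memDelta; exists u => // x.
  rewrite !inE => /predU1P[->|/leu//].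
  move: wL; rewrite inE => /eqP wE; rewrite -ltnS wE wv.
  exact: leq_ltn_trans (leu v vs) (ltn_ord _).
(* On last copies, the name of the variable determines the vertex. *)
rewrite (@dim_homology_relabel k n m (fun v => tag (pv v)) L); first last.
- by move=> s; rewrite inE => /andP[].
- move=> s t; rewrite !inE => /andP[sD sL] ts.
  by rewrite (hDelta s) //= (subset_trans ts).
- move=> v w; rewrite !inE => /eqP vL /eqP wL tvw; apply: inj_phi.
  apply: enum_val_inj; apply: polvar_eq => //.
  by apply: succn_inj; rewrite vL wL tvw.
congr (dim_reduced_homology _ _ _); apply/setP => s; apply/imsetP/idP.
  move=> [t]; rewrite inE => /andP[/memDelta[u Du leu] /subsetP tL] ->.
  apply/(mem_koszul_lcm monD leDmu); exists u => // _ /imsetP[v vt ->].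
  by have := tL v vt; rewrite inE => /eqP <-; rewrite ltnS leu.
move=> /(mem_koszul_lcm monD leDmu)[u Du ltu].
exists [set v in L | tag (pv v) \in s].
  rewrite inE; apply/andP; split; last by apply/subsetP => v; rewrite inE => /andP[].
  apply/memDelta; exists u => // v; rewrite !inE => /andP[/eqP vL /ltu ltuv].
  by rewrite -ltnS vL.
apply/setP => j; apply/idP/imsetP => [js|[v]].
  have [v vL vj] := last_vertex j (leq_ltn_trans (leq0n _) (ltu j js)).
  by exists v => //; rewrite inE; apply/andP; split; rewrite // vj.
by rewrite inE => /andP[_ vs] ->.
Qed.
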